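(* Let $S$ be a commutative semigroup and $A$ a vector space. Under the correspondence between maps of $S$-graded spaces $\mathcal{U}(A)\bullet\mathcal{U}(A)\to\mathcal{U}(A)$ and families of bilinear operations on $A$ indexed by $S^2$ given by taking components, commutative (respectively Lie, Poisson) monoid structures on the uniform object $\mathcal{U}(A)$ in the symmetric monoidal category $\mathrm{Vec}_S$ are the same as $S$-relative commutative (respectively Lie, Poisson) algebra structures on $A$.
   Context: Vector spaces are over a field $\mathbb{K}$. An $S$-graded space is a collection $\mathcal{V}=(V_\alpha)_{\alpha\in S}$ of vector spaces; a morphism is a collection of linear maps $V_\alpha\to W_\alpha$. The category $\mathrm{Vec}_S$ is (not necessarily unital) monoidal under $(\mathcal{V}\bullet\mathcal{W})_\gamma=\bigoplus_{\gamma=\alpha\beta}V_\alpha\otimes W_\beta$, and, $S$ being commutative, symmetric, with symmetry $\sigma$ assembled from the switch maps $V_\alpha\otimes W_\beta\to W_\beta\otimes V_\alpha$, $x\otimes y\mapsto y\otimes x$. For a vector space $V$, $\mathcal{U}(V)$ is the $S$-graded space with $\mathcal{U}(V)_\alpha=V$ for all $\alpha$ (a ''uniform'' object). The components of a map $\mu\colon\mathcal{U}(A)\bullet\mathcal{U}(A)\to\mathcal{U}(A)$ are the linear maps $A\otimes A=\mathcal{U}(A)_\alpha\otimes\mathcal{U}(A)_\beta\to\mathcal{U}(A)_{\alpha\beta}=A$, one for each $(\alpha,\beta)\in S^2$. Monoids in a linear symmetric monoidal category with symmetry $\sigma$ (associativity constraints suppressed, juxtaposition denotes composition): - A commutative monoid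 is an object $M$ with $\mu\colon M\bullet M\to M$ such that $\mu(\mathrm{id}\bullet\mu)=\mu(\mu\bullet\mathrm{id})$ and $\mu\sigma=\mu$ (no unit required). - A Lie monoid is an object $L$ with $\ell\colon L\bullet L\to L$ such that $\ell+\ell\sigma=0$ and $\ell(\ell\bullet\mathrm{id})(\mathrm{id}+\xi+\xi^2)=0$, where $\xi\colon L\bullet L\bullet L\to L\bullet L\bullet L$ is the cyclic permutation of the three factors induced by $\sigma$. - A Poisson monoid is an object with both a commutative monoid structure $\mu$ and a Lie monoid structure $\ell$ such that $\ell(\mathrm{id}\bullet\mu)=\mu(\ell\bullet\mathrm{id})+\mu(\mathrm{id}\bullet\ell)(\sigma\bullet\mathrm{id})$. $S$-relative algebras (all operations bilinear; identities required for all $x,y,z$ in the space and all $\alpha,\beta,\gamma\in S$): - An $S$-relative commutative algebra is a vector space $A$ with operations $\cdot_{\alpha,\beta}$, $(\alpha,\beta)\in S^2$, such that $(x\cdot_{\alpha,\beta}y)\cdot_{\alpha\beta,\gamma}z=x\cdot_{\alpha,\beta\gamma}(y\cdot_{\beta,\gamma}z)$ and $x\cdot_{\alpha,\beta}y=y\cdot_{\beta,\alpha}x$. - An $S$-relative Lie algebra is a vector space with operations $[-,-]_{\alpha,\beta}$, $(\alpha,\beta)\in S^2$, such that $[x,y]_{\alpha,\beta}+[y,x]_{\beta,\alpha}=0$ and $\big[[x,y]_{\alpha,\beta},z\big]_{\alpha\beta,\gamma}+\big[[z,x]_{\gamma,\alpha},y\big]_{\gamma\alpha,\beta}+\big[[y,z]_{\beta,\gamma},x\big]_{\beta\gamma,\alpha}=0$.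 - An $S$-relative Poisson algebra is a vector space with both an $S$-relative commutative and an $S$-relative Lie algebra structure such that $[x,y\cdot_{\beta,\gamma}z]_{\alpha,\beta\gamma}=[x,y]_{\alpha,\beta}\cdot_{\alpha\beta,\gamma}z+y\cdot_{\beta,\alpha\gamma}[x,z]_{\alpha,\gamma}$. *)

(* Defs.v *)
From HB Require Import structures.
From mathcomp Require Import all_boot all_algebra.
From mathcomp Require Import boolp.

Set Implicit Arguments.
Unset Strict Implicit.
Unset Printing Implicit Defensive.

Import GRing.Theory.
Local Open Scope ring_scope.
Local Open Scope quotient_scope.

Section LinearMaps.
Variables (K : fieldType) (V W : lmodType K).
Implicit Types (f g h : {linear V -> W}) (a b : K).

Lemma linear_ext f g : f =1 g -> f = g.
Proof.
move: f g => [f [[f1] [f2]]] [g [[g1] [g2]]] /= /funext fg.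
by subst g; rewrite (Prop_irrelevance f1 g1) (Prop_irrelevance f2 g2).
Qed.

HB.instance Definition _ := gen_eqMixin {linear V -> W}.
HB.instance Definition _ := gen_choiceMixin {linear V -> W}.

Definition lin_zero : {linear V -> W} := \0.
Definition lin_add f g : {linear V -> W} := f \+ g.
Definition lin_opp f : {linear V -> W} := \- f.
Definition lin_scale a f : {linear V -> W} := a \*: f.

Fact lin_addA : associative lin_add.
Proof. by move=> f g h; apply: linear_ext => x /=; rewrite addrA. Qed.
Fact lin_addC : commutative lin_add.
Proof. by move=> f g; apply: linear_ext => x /=; rewrite addrC. Qed.
Fact lin_add0 : left_id lin_zero lin_add.
Proof. by move=> f; apply: linear_ext => x /=; rewrite add0r. Qed.
Fact lin_addN : left_inverse lin_zero lin_opp lin_add.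
Proof. by move=> f; apply: linear_ext => x /=; rewrite addNr. Qed.

HB.instance Definition _ :=
  GRing.isZmodule.Build {linear V -> W} lin_addA lin_addC lin_add0 lin_addN.

Fact lin_scaleA a b f : lin_scale a (lin_scale b f) = lin_scale (a * b) f.
Proof. by apply: linear_ext => x /=; rewrite scalerA. Qed.
Fact lin_scale1 : left_id 1 lin_scale.
Proof. by move=> f; apply: linear_ext => x /=; rewrite scale1r. Qed.
Fact lin_scaleDr : right_distributive lin_scale +%R.
Proof. by move=> a f g; apply: linear_ext => x /=; rewrite scalerDr. Qed.
Fact lin_scaleDl f : {morph lin_scale^~ f : a b / a + b}.
Proof. by move=> a b; apply: linear_ext => x /=; rewrite scalerDl. Qed.

HB.instance Definition _ := GRing.Zmodule_isLmodule.Build K {linear V -> W}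
  lin_scaleA lin_scale1 lin_scaleDr lin_scaleDl.

End LinearMaps.

Section MakeLinear.
Variable K : fieldType.

Definition mklin (V W : lmodType K) (f : V -> W) (f_lin : linear f) :
    {linear V -> W} :=
  HB.pack f (GRing.isLinear.Build K V W *:%R f f_lin).

Definition mkbilin (U V W : lmodType K) (f : U -> V -> W)
    (f_linl : forall v, linear (f^~ v)) (f_linr : forall u, linear (f u)) :
    {linear U -> {linear V -> W}}.
Proof.
by refine (@mklin _ _ (fun u => mklin (f_linr u)) _) => a x y;
   apply: linear_ext => v; apply: f_linl.
Defined.

Section Trilinear.
Variables (U V W Z : lmodType K) (f : U -> V -> W -> Z).
Hypothesis f_lin1 : forall v w, linear (fun u => f u v w).
Hypothesis f_lin2 : forall u w, linear (fun v => f u v w).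
Hypothesis f_lin3 : forall u v, linear (f u v).

Fact mktrilin_linear : linear (fun u => mkbilin (f_lin2 u) (f_lin3 u)).
Proof.
by move=> a u u'; apply: linear_ext => v; apply: linear_ext => w; apply: f_lin1.
Qed.

Definition mktrilin : {linear U -> {linear V -> {linear W -> Z}}} :=
  mklin mktrilin_linear.

End Trilinear.

Section Flip.
Variables (U V Z : lmodType K) (f : {linear U -> {linear V -> Z}}).

Fact flip_linearl u : linear (fun v => f u v).
Proof. by move=> a v v'; rewrite linearP. Qed.
Fact flip_linearr v : linear (fun u => f u v).
Proof. by move=> a u u'; rewrite linearP. Qed.

Definition linflip : {linear V -> {linear U -> Z}} :=
  mkbilin flip_linearl flip_linearr.

Lemma linflipE v u : linflip v u = f u v. Proof. by []. Qed.

End Flip.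

End MakeLinear.

Section DirectProduct.
Variables (K : fieldType) (I : Type) (F : I -> lmodType K).

Definition dprod := forall i, F i.

HB.instance Definition _ := gen_eqMixin dprod.
HB.instance Definition _ := gen_choiceMixin dprod.

Implicit Types x y z : dprod.
Definition dprod_zero : dprod := fun=> 0.
Definition dprod_add x y : dprod := fun i => x i + y i.
Definition dprod_opp x : dprod := fun i => - x i.
Definition dprod_scale (a : K) x : dprod := fun i => a *: x i.

Lemma dprod_ext x y : (forall i, x i = y i) -> x = y.
Proof. exact: functional_extensionality_dep. Qed.

Fact dprod_addA : associative dprod_add.
Proof. by move=> x y z; apply: dprod_ext => i; apply: addrA. Qed.
Fact dprod_addC : commutative dprod_add.
Proof. by move=> x y; apply: dprod_ext => i; apply: addrC. Qed.
Fact dprod_add0 : left_id dprod_zero dprod_add.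
Proof. by move=> x; apply: dprod_ext => i; apply: add0r. Qed.
Fact dprod_addN : left_inverse dprod_zero dprod_opp dprod_add.
Proof. by move=> x; apply: dprod_ext => i; apply: addNr. Qed.

HB.instance Definition _ :=
  GRing.isZmodule.Build dprod dprod_addA dprod_addC dprod_add0 dprod_addN.

Fact dprod_scaleA a b x :
  dprod_scale a (dprod_scale b x) = dprod_scale (a * b) x.
Proof. by apply: dprod_ext => i; apply: scalerA. Qed.
Fact dprod_scale1 : left_id 1 dprod_scale.
Proof. by move=> x; apply: dprod_ext => i; apply: scale1r. Qed.
Fact dprod_scaleDr : right_distributive dprod_scale +%R.
Proof. by move=> a x y; apply: dprod_ext => i; apply: scalerDr. Qed.
Fact dprod_scaleDl x : {morph dprod_scale^~ x : a b / a + b}.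
Proof. by move=> a b; apply: dprod_ext => i; apply: scalerDl. Qed.

HB.instance Definition _ := GRing.Zmodule_isLmodule.Build K dprod
  dprod_scaleA dprod_scale1 dprod_scaleDr dprod_scaleDl.

Lemma dprodDE x y i : (x + y) i = x i + y i. Proof. by []. Qed.
Lemma dprodZE a x i : (a *: x) i = a *: x i. Proof. by []. Qed.

End DirectProduct.

Section DirectSum.
Variables (K : fieldType) (I : choiceType) (F : I -> lmodType K).

Definition supported (x : dprod F) (s : seq I) :=
  forall i, i \notin s -> x i = 0.

Definition finsupp : {pred dprod F} := fun x => `[< exists s, supported x s >].

Fact finsupp_submod : submod_closed finsupp.
Proof.
split=> [|a x y /asboolP[s xs] /asboolP[t yt]]; apply/asboolP.
  by exists [::].
exists (s ++ t) => i; rewrite mem_cat negb_or => /andP[si ti].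
by rewrite dprodDE dprodZE xs // yt // scaler0 add0r.
Qed.

HB.instance Definition _ := GRing.isSubmodClosed.Build K (dprod F) finsupp
  finsupp_submod.

Record dsum := DSum { dsum_val : dprod F; dsum_valP : dsum_val \in finsupp }.

HB.instance Definition _ := [isSub for dsum_val].
HB.instance Definition _ := [Choice of dsum by <:].
HB.instance Definition _ := [SubChoice_isSubLmodule of dsum by <:].
Lemma dsum_ext (x y : dsum) : (forall i, val x i = val y i) -> x = y.
Proof. by move=> xy; apply/val_inj/dprod_ext. Qed.

Fact dsum_inj_subproof i (v : F i) :
  (dfwith (fun=> 0) v : dprod F) \in finsupp.
Proof.
apply/asboolP; exists [:: i] => j; rewrite inE => ji.
by rewrite dfwith_out // eq_sym.
Qed.

Fact dsum_inj_linear i :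
  linear (fun v : F i => DSum (dsum_inj_subproof v)).
Proof.
move=> a v w; apply: dsum_ext => j; rewrite linearP /= dprodDE dprodZE.
case: (eqVneq i j) => [ij|ij].
  by case: j / ij; rewrite !dfwith_in.
by rewrite !dfwith_out // scaler0 addr0.
Qed.

Definition dsum_inj i : {linear F i -> dsum} := mklin (@dsum_inj_linear i).

Lemma dsum_inj_in i v : val (dsum_inj i v) i = v.
Proof. exact: dfwith_in. Qed.

Lemma dsum_inj_out i j v : i != j -> val (dsum_inj i v) j = 0.
Proof. exact: dfwith_out. Qed.

Definition dsum_supp (x : dsum) : seq I :=
  undup (projT1 (cid (asboolW (dsum_valP x)))).

Lemma dsum_suppP x : supported (val x) (dsum_supp x).
Proof.
by rewrite /dsum_supp; case: cid => s xs i /=; rewrite mem_undup => /xs.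
Qed.

Section Lift.
Variables (Z : lmodType K) (f : forall i, {linear F i -> Z}).

Definition dsum_lift_fun (x : dsum) : Z :=
  \sum_(i <- dsum_supp x) f i (val x i).

Lemma dsum_lift_supp x s : uniq s -> supported (val x) s ->
  dsum_lift_fun x = \sum_(i <- s) f i (val x i).
Proof.
have bigsupp t : \sum_(i <- t) f i (val x i) =
    \sum_(i <- [seq i <- t | val x i != 0]) f i (val x i).
  rewrite big_filter [LHS](bigID (fun i => val x i != 0)) /=.
  by rewrite [X in _ + X]big1 ?addr0 // => i /negPn/eqP ->; rewrite linear0.
move=> s_uniq xs; rewrite /dsum_lift_fun bigsupp [RHS]bigsupp.
apply: perm_big; apply: uniq_perm; rewrite ?filter_uniq ?undup_uniq // => i.
rewrite !mem_filter; case: eqVneq => //= xi.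
have /negPn-> : ~~ (i \notin s).
  by apply/negP => /xs; apply/eqP.
by apply: negbNE; apply/negP => /dsum_suppP; apply/eqP.
Qed.

Fact dsum_lift_linear : linear dsum_lift_fun.
Proof.
move=> a x y; pose s := undup (dsum_supp x ++ dsum_supp y).
have xs : supported (val x) s.
  move=> i; rewrite mem_undup mem_cat negb_or => /andP[xi _].
  exact: dsum_suppP.
have ys : supported (val y) s.
  move=> i; rewrite mem_undup mem_cat negb_or => /andP[_ yi].
  exact: dsum_suppP.
have xyE i : val (a *: x + y) i = a *: val x i + val y i by [].
have xys : supported (val (a *: x + y)) s.
  by move=> i si; rewrite xyE xs // ys // scaler0 addr0.
rewrite !(@dsum_lift_supp _ s) ?undup_uniq // scaler_sumr -big_split /=.
by apply: eq_bigr => i _; rewrite dprodDE dprodZE linearP.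
Qed.

Definition dsum_lift : {linear dsum -> Z} := mklin dsum_lift_linear.

Lemma dsum_lift_inj i v : dsum_lift (dsum_inj i v) = f i v.
Proof.
rewrite /= (@dsum_lift_supp _ [:: i]) //.
  by rewrite big_seq1 dsum_inj_in.
by move=> j; rewrite inE eq_sym => ij; apply: dsum_inj_out.
Qed.

End Lift.

Lemma dsum_expand x :
  x = \sum_(i <- dsum_supp x) dsum_inj i (val x i).
Proof.
have sumE t j : val (\sum_(i <- t) dsum_inj i (val x i)) j =
    \sum_(i <- t) val (dsum_inj i (val x i)) j.
  by elim: t => [|i t IHt]; rewrite ?big_nil // !big_cons -IHt.
apply: dsum_ext => j; rewrite sumE.
case: (boolP (j \in dsum_supp x)) => jx.
  rewrite (bigD1_seq j) ?undup_uniq // dsum_inj_in big1 => [|i ij].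
    by rewrite /= addr0.
  exact: dsum_inj_out.
rewrite dsum_suppP // big_seq big1 // => i ix.
by apply: dsum_inj_out; apply: contraNneq jx => <-.
Qed.

Lemma dsum_lin_ext (Z : lmodType K) (f g : {linear dsum -> Z}) :
  (forall i v, f (dsum_inj i v) = g (dsum_inj i v)) -> f =1 g.
Proof.
move=> fg x; rewrite (dsum_expand x) !linear_sum.
by apply: eq_bigr => i _; apply: fg.
Qed.

End DirectSum.

Section Quotient.
Variables (K : fieldType) (V : lmodType K) (G : V -> Prop).

Inductive in_span : V -> Prop :=
| in_span_gen u of G u : in_span u
| in_span0 : in_span 0
| in_span_lin a u v of in_span u & in_span v : in_span (a *: u + v).

Definition span_pred : {pred V} := fun u => `[< in_span u >].

Fact span_pred_submod : submod_closed span_pred.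
Proof.
split=> [|a u v /asboolP uS /asboolP vS]; apply/asboolP; first exact: in_span0.
exact: in_span_lin.
Qed.

HB.instance Definition _ := GRing.isSubmodClosed.Build K V span_pred
  span_pred_submod.

Definition lquot := Quotient.quot span_pred.

HB.instance Definition _ := GRing.Zmodule.on lquot.

Definition lquot_pi (u : V) : lquot := \pi u.

Lemma lquot_piP u v : (lquot_pi u = lquot_pi v) <-> in_span (u - v).
Proof.
split=> [/eqP|uv]; first by rewrite /lquot_pi -Quotient.idealrBE => /asboolP.
by apply/eqP; rewrite /lquot_pi -Quotient.idealrBE; apply/asboolP.
Qed.

Lemma lquot_reprK (x : lquot) : lquot_pi (repr x) = x.
Proof. exact: reprK. Qed.

Definition lquot_scale (a : K) (x : lquot) : lquot := lquot_pi (a *: repr x).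

Lemma lquot_piB u v : lquot_pi (u - v) = lquot_pi u - lquot_pi v.
Proof. exact: raddfB. Qed.

Lemma lquot_piD u v : lquot_pi (u + v) = lquot_pi u + lquot_pi v.
Proof. exact: raddfD. Qed.

Lemma lquot_piZ a u : lquot_pi (a *: u) = lquot_scale a (lquot_pi u).
Proof.
apply/lquot_piP; rewrite -scalerBr -[_ *: _]addr0.
by apply: in_span_lin in_span0; apply/lquot_piP; rewrite lquot_reprK.
Qed.

Fact lquot_scaleA a b x :
  lquot_scale a (lquot_scale b x) = lquot_scale (a * b) x.
Proof. by rewrite -(lquot_reprK x) -!lquot_piZ scalerA. Qed.
Fact lquot_scale1 : left_id 1 lquot_scale.
Proof. by move=> x; rewrite -(lquot_reprK x) -!lquot_piZ scale1r. Qed.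
Fact lquot_scaleDr : right_distributive lquot_scale +%R.
Proof.
move=> a x y; rewrite -(lquot_reprK x) -(lquot_reprK y).
by rewrite -lquot_piD -!lquot_piZ scalerDr lquot_piD.
Qed.
Fact lquot_scaleDl x : {morph lquot_scale^~ x : a b / a + b}.
Proof.
by move=> a b; rewrite -(lquot_reprK x) -!lquot_piZ scalerDl lquot_piD.
Qed.

HB.instance Definition _ := GRing.Zmodule_isLmodule.Build K lquot
  lquot_scaleA lquot_scale1 lquot_scaleDr lquot_scaleDl.

Fact lquot_pi_linear : linear lquot_pi.
Proof. by move=> a u v; rewrite lquot_piD lquot_piZ. Qed.

Definition lquot_proj : {linear V -> lquot} := mklin lquot_pi_linear.

Lemma lquot_proj_eq u v : G (u - v) -> lquot_proj u = lquot_proj v.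
Proof. by move=> uv; apply/lquot_piP/in_span_gen. Qed.

Section Lift.
Variables (Z : lmodType K) (f : {linear V -> Z}).
Hypothesis fG : forall u, G u -> f u = 0.

Lemma lquot_lift_piE u : f (repr (lquot_pi u)) = f u.
Proof.
have span0 v : in_span v -> f v = 0.
  by elim=> [w /fG||a v' w _ v0 _ w0] //;
    rewrite ?linear0 // linearP v0 w0 scaler0 addr0.
apply/eqP; rewrite -subr_eq0 -linearB; apply/eqP/span0/lquot_piP.
by rewrite lquot_reprK.
Qed.

Fact lquot_lift_linear : linear (fun x : lquot => f (repr x)).
Proof.
move=> a x y; rewrite -{1}(lquot_reprK x) -{1}(lquot_reprK y).
by rewrite -lquot_pi_linear lquot_lift_piE linearP.
Qed.

Definition lquot_lift : {linear lquot -> Z} := mklin lquot_lift_linear.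

Lemma lquot_liftE u : lquot_lift (lquot_proj u) = f u.
Proof. exact: lquot_lift_piE. Qed.

End Lift.

Lemma lquot_lin_ext (Z : lmodType K) (f g : {linear lquot -> Z}) :
  (forall u, f (lquot_proj u) = g (lquot_proj u)) -> f =1 g.
Proof. by move=> fg x; rewrite -(lquot_reprK x); apply: fg. Qed.

End Quotient.

(* The tensor product: the free vector space on V x W (a direct sum of copies
   of K) modulo bilinearity. *)
Section Tensor.
Variables (K : fieldType) (V W : lmodType K).

Definition free_prod := dsum (fun _ : V * W => K^o : lmodType K).

HB.instance Definition _ := GRing.Lmodule.on free_prod.

Definition free_pair (x : V) (y : W) : free_prod :=
  dsum_inj (fun _ : V * W => K^o) (x, y) 1.

Variant bilin_rel : free_prod -> Prop :=
| BilinRelL a x x' y : bilin_rel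
    (free_pair (a *: x + x') y - (a *: free_pair x y + free_pair x' y))
| BilinRelR a x y y' : bilin_rel
    (free_pair x (a *: y + y') - (a *: free_pair x y + free_pair x y')).

Definition tensor := lquot bilin_rel.

HB.instance Definition _ := GRing.Lmodule.on tensor.

Definition tens_proj : {linear free_prod -> tensor} := lquot_proj bilin_rel.

Fact tens_linearl y : linear (fun x => tens_proj (free_pair x y)).
Proof. by move=> a x x'; rewrite -linearP; apply: lquot_proj_eq; left. Qed.
Fact tens_linearr x : linear (fun y => tens_proj (free_pair x y)).
Proof. by move=> a y y'; rewrite -linearP; apply: lquot_proj_eq; right. Qed.

Definition tens : {linear V -> {linear W -> tensor}} :=
  mkbilin tens_linearl tens_linearr.

Section Lift.
Variables (Z : lmodType K) (f : {linear V -> {linear W -> Z}}).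

Fact free_lift_linear (p : V * W) : linear (fun a : K^o => a *: f p.1 p.2).
Proof. by move=> a x y; rewrite scalerDl scalerA. Qed.

Definition free_lift : {linear free_prod -> Z} :=
  dsum_lift (fun p => mklin (@free_lift_linear p)).

Lemma free_lift_pair x y : free_lift (free_pair x y) = f x y.
Proof. by rewrite [LHS]dsum_lift_inj /= scale1r. Qed.

Fact free_lift_rel u : bilin_rel u -> free_lift u = 0.
Proof.
case=> [a x x' y|a x y y']; rewrite linearB linearP !free_lift_pair.
  by rewrite [f (_ + _)]linearP subrr.
by rewrite linearP subrr.
Qed.

Definition tens_lift : {linear tensor -> Z} := lquot_lift free_lift_rel.

Lemma tens_liftE x y : tens_lift (tens x y) = f x y.
Proof. by rewrite [LHS]lquot_liftE free_lift_pair. Qed.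

End Lift.

Lemma tens_lin_ext (Z : lmodType K) (f g : {linear tensor -> Z}) :
  (forall x y, f (tens x y) = g (tens x y)) -> f =1 g.
Proof.
move=> fg; apply: lquot_lin_ext => u.
pose f' : {linear free_prod -> Z} := f \o tens_proj.
pose g' : {linear free_prod -> Z} := g \o tens_proj.
rewrite -[LHS]/(f' u) -[RHS]/(g' u).
apply: dsum_lin_ext => -[x y] a.
have -> : dsum_inj (fun _ : V * W => K^o : lmodType K) (x, y) a =
          a *: free_pair x y.
  by rewrite -linearZ /= [a *: _]mulr1.
by rewrite !linearZ; congr (_ *: _); apply: fg.
Qed.

End Tensor.

Arguments dsum_inj {K I F} i.
Arguments dsum_lift {K I F Z} f : simpl never.
Arguments tens {K V W} : simpl never.
Arguments tens_lift {K V W Z} f : simpl never.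

(* No unit object is required.  One hexagon suffices, since msym is an
   involution. *)
Record linSymMonCat (K : fieldType) := LinSymMonCat {
  obj : Type;
  mor : obj -> obj -> lmodType K;
  mid : forall X, mor X X;
  mcomp : forall X Y Z, mor Y Z -> mor X Y -> mor X Z;
  tob : obj -> obj -> obj;
  tmap : forall X X' Y Y',
    mor X X' -> mor Y Y' -> mor (tob X Y) (tob X' Y');
  massoc : forall X Y Z, mor (tob (tob X Y) Z) (tob X (tob Y Z));
  massocV : forall X Y Z, mor (tob X (tob Y Z)) (tob (tob X Y) Z);
  msym : forall X Y, mor (tob X Y) (tob Y X);

  comp1m : forall X Y (f : mor X Y), mcomp (mid Y) f = f;
  compm1 : forall X Y (f : mor X Y), mcomp f (mid X) = f;
  compA : forall X Y Z T (h : mor Z T) (g : mor Y Z) (f : mor X Y),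
    mcomp h (mcomp g f) = mcomp (mcomp h g) f;
  comp_linl : forall X Y Z (f : mor X Y),
    linear (fun g : mor Y Z => mcomp g f);
  comp_linr : forall X Y Z (g : mor Y Z),
    linear (fun f : mor X Y => mcomp g f);

  tmap1 : forall X Y, tmap (mid X) (mid Y) = mid (tob X Y);
  tmap_comp : forall X X' X'' Y Y' Y'' (f' : mor X' X'') (f : mor X X')
      (g' : mor Y' Y'') (g : mor Y Y'),
    tmap (mcomp f' f) (mcomp g' g) = mcomp (tmap f' g') (tmap f g);
  tmap_linl : forall X X' Y Y' (g : mor Y Y'),
    linear (fun f : mor X X' => tmap f g);
  tmap_linr : forall X X' Y Y' (f : mor X X'),
    linear (fun g : mor Y Y' => tmap f g);

  assocK : forall X Y Z, mcomp (massocV X Y Z) (massoc X Y Z) = mid _;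
  assocVK : forall X Y Z, mcomp (massoc X Y Z) (massocV X Y Z) = mid _;
  assoc_nat : forall X X' Y Y' Z Z'
      (f : mor X X') (g : mor Y Y') (h : mor Z Z'),
    mcomp (massoc X' Y' Z') (tmap (tmap f g) h) =
    mcomp (tmap f (tmap g h)) (massoc X Y Z);
  pentagon : forall X Y Z T,
    mcomp (massoc X Y (tob Z T)) (massoc (tob X Y) Z T) =
    mcomp (tmap (mid X) (massoc Y Z T))
      (mcomp (massoc X (tob Y Z) T) (tmap (massoc X Y Z) (mid T)));

  msymK : forall X Y, mcomp (msym Y X) (msym X Y) = mid _;
  sym_nat : forall X X' Y Y' (f : mor X X') (g : mor Y Y'),
    mcomp (msym X' Y') (tmap f g) = mcomp (tmap g f) (msym X Y);
  hexagon : forall X Y Z,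
    mcomp (massoc Y Z X) (mcomp (msym X (tob Y Z)) (massoc X Y Z)) =
    mcomp (tmap (mid Y) (msym X Z))
      (mcomp (massoc Y X Z) (tmap (msym X Y) (mid Z)))
}.

Arguments mid {K C} X : rename.
Arguments mcomp {K C X Y Z} g f : rename.
Arguments tob {K C} X Y : rename.
Arguments tmap {K C X X' Y Y'} f g : rename.
Arguments massoc {K C} X Y Z : rename.
Arguments massocV {K C} X Y Z : rename.
Arguments msym {K C} X Y : rename.

Local Notation "g \oc f" := (mcomp g f) (at level 40, left associativity).
Local Notation "X \bx Y" := (tob X Y) (at level 38, left associativity).
Local Notation "f \bxm g" := (tmap f g) (at level 38, left associativity).

Section Monoids.
Variables (K : fieldType) (C : linSymMonCat K) (M : obj C).

(* Associators are explicit below; the ternary laws are between morphisms out of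
   (M M) M. *)
Definition is_comm_monoid (mu : mor (M \bx M) M) : Prop :=
  mu \oc (mid M \bxm mu) \oc massoc M M M = mu \oc (mu \bxm mid M) /\
  mu \oc msym M M = mu.

(* (x y) z |-> (z x) y *)
Definition cyc3 : mor (M \bx M \bx M) (M \bx M \bx M) :=
  massocV M M M \oc msym (M \bx M) M.

Definition is_lie_monoid (l : mor (M \bx M) M) : Prop :=
  l + l \oc msym M M = 0 /\
  l \oc (l \bxm mid M) \oc (mid (M \bx M \bx M) + cyc3 + cyc3 \oc cyc3) = 0.

Definition is_poisson_monoid (mu l : mor (M \bx M) M) : Prop :=
  [/\ is_comm_monoid mu, is_lie_monoid l &
      l \oc (mid M \bxm mu) \oc massoc M M M =
      mu \oc (l \bxm mid M) +
      mu \oc (mid M \bxm l) \oc massoc M M M \oc (msym M M \bxm mid M)].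

End Monoids.

(* The commutative semigroup S is written additively, as is the convention for
   addSemigroupType. *)
Section GradedSpaces.
Variables (K : fieldType) (S : addSemigroupType).

Definition gspace := S -> lmodType K.
Implicit Types (U V W X : gspace).

Definition ghom V W : lmodType K := dprod (fun a => {linear V a -> W a}).

Definition gidm V : ghom V V := fun a => idfun.

Definition gcomp U V W (g : ghom V W) (f : ghom U V) : ghom U W :=
  fun a => g a \o f a.

Definition decomp (c : S) := {p : S * S | p.1 + p.2 == c}.

Definition gtens V W : gspace := fun c =>
  dsum (fun p : decomp c => tensor (V (val p).1) (W (val p).2)).

Section Generators.
Variables (V W : gspace) (a b c : S) (abc : a + b = c).

Definition decomp_of : decomp c := exist _ (a, b) (introT eqP abc).

(* The pure tensor of x and y in the summand of index (a, b); abc : a + b = c is an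
   argument so that no transport between degrees is ever needed. *)
Definition ggen_fun (x : V a) (y : W b) : gtens V W c :=
  dsum_inj decomp_of (tens x y).

Fact ggen_linearl y : linear (ggen_fun^~ y).
Proof. by move=> k x x'; rewrite /ggen_fun linearP [LHS]linearP. Qed.
Fact ggen_linearr x : linear (ggen_fun x).
Proof. by move=> k y y'; rewrite /ggen_fun linearP [LHS]linearP. Qed.

Definition ggen : {linear V a -> {linear W b -> gtens V W c}} :=
  mkbilin ggen_linearl ggen_linearr.

End Generators.
Arguments ggen V W {a b c} abc : simpl never.

Section Lift.
Variables (V W : gspace) (c : S) (Z : lmodType K).
Variable f : forall a b, a + b = c -> {linear V a -> {linear W b -> Z}}.

Definition glift : {linear gtens V W c -> Z} :=
  dsum_lift (fun p : decomp c => tens_lift (f (elimT eqP (valP p)))).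

Lemma gliftE a b (abc : a + b = c) x y : glift (ggen V W abc x y) = f abc x y.
Proof.
rewrite [LHS]dsum_lift_inj tens_liftE /=.
by congr (f _ x y); apply: eq_irrelevance.
Qed.

End Lift.
Arguments glift {V W c Z} f : simpl never.

Lemma gtens_ext V W c (Z : lmodType K) (f g : {linear gtens V W c -> Z}) :
  (forall a b (abc : a + b = c) x y,
     f (ggen V W abc x y) = g (ggen V W abc x y)) ->
  f = g.
Proof.
move=> fg; apply/linear_ext/dsum_lin_ext => -[[a b] /= abc].
pose i : {linear _ -> gtens V W c} :=
  dsum_inj (F := fun p : decomp c => tensor (V (val p).1) (W (val p).2))
    (exist _ (a, b) abc).
pose f' : {linear tensor (V a) (W b) -> Z} := f \o i.
pose g' : {linear tensor (V a) (W b) -> Z} := g \o i.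
move=> v; rewrite -[LHS]/(f' v) -[RHS]/(g' v); apply: tens_lin_ext => x y.
have := fg a b (elimT eqP abc) x y.
by rewrite /= /ggen_fun /decomp_of (bool_irrelevance (introT _ _) abc).
Qed.

Section TensorMap.
Variables (V V' W W' : gspace) (f : ghom V V') (g : ghom W W').
Variables (c a b : S) (abc : a + b = c).

Fact gtmap_linearl y : linear (fun x => ggen V' W' abc (f a x) (g b y)).
Proof. by move=> k x x'; rewrite linearP [ggen _ _ _ _]linearP. Qed.
Fact gtmap_linearr x : linear (fun y => ggen V' W' abc (f a x) (g b y)).
Proof. by move=> k y y'; rewrite !linearP. Qed.

End TensorMap.

Definition gtmap V V' W W' (f : ghom V V') (g : ghom W W') :
    ghom (gtens V W) (gtens V' W') :=
  fun c => glift (fun a b abc =>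
    mkbilin (gtmap_linearl f g abc) (gtmap_linearr f g abc)).

Section Symmetry.
Variables (V W : gspace) (c a b : S) (abc : a + b = c).

Definition decompC : b + a = c := etrans (Algebra.addrC b a) abc.

Fact gsym_linearl y : linear (fun x => ggen W V decompC y x).
Proof. by move=> k x x'; rewrite linearP. Qed.
Fact gsym_linearr x : linear (fun y => ggen W V decompC y x).
Proof. by move=> k y y'; rewrite [ggen _ _ _ _]linearP. Qed.

End Symmetry.

Definition gsym V W : ghom (gtens V W) (gtens W V) :=
  fun c => glift (fun a b abc =>
    mkbilin (@gsym_linearl V W c a b abc) (@gsym_linearr V W c a b abc)).

Section Associator.
Variables (U V W : gspace) (d a b c g : S).

Section Right.
Hypotheses (gc : g + c = d) (ab : a + b = g).

Definition decompA : a + (b + c) = d.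
Proof. by rewrite Algebra.addrA ab. Qed.

Definition gassoc_gen (u : U a) (v : V b) (w : W c) :
    gtens U (gtens V W) d :=
  ggen U (gtens V W) decompA u (ggen V W erefl v w).

Fact gassoc_linear1 v w : linear (fun u => gassoc_gen u v w).
Proof. by move=> k u u'; rewrite /gassoc_gen linearP. Qed.
Fact gassoc_linear2 u w : linear (fun v => gassoc_gen u v w).
Proof.
by move=> k v v'; rewrite /gassoc_gen [ggen V W _ _]linearP [LHS]linearP.
Qed.
Fact gassoc_linear3 u v : linear (gassoc_gen u v).
Proof. by move=> k w w'; rewrite /gassoc_gen !linearP. Qed.
End Right.

Section Left.
Hypotheses (ag : a + g = d) (bc : b + c = g).

Definition decompAV : (a + b) + c = d.
Proof. by rewrite -Algebra.addrA bc. Qed.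

Definition gassocV_gen (v : V b) (w : W c) (u : U a) :
    gtens (gtens U V) W d :=
  ggen (gtens U V) W decompAV (ggen U V erefl u v) w.

Fact gassocV_linear1 w u : linear (fun v => gassocV_gen v w u).
Proof. by move=> k v v'; rewrite /gassocV_gen !linearP. Qed.
Fact gassocV_linear2 v u : linear (fun w => gassocV_gen v w u).
Proof. by move=> k w w'; rewrite /gassocV_gen !linearP. Qed.
Fact gassocV_linear3 v w : linear (gassocV_gen v w).
Proof.
by move=> k u u'; rewrite /gassocV_gen [ggen U V _ _]linearP !linearP.
Qed.
End Left.

End Associator.

Definition gassoc U V W : ghom (gtens (gtens U V) W) (gtens U (gtens V W)) :=
  fun d => glift (fun g c gc => glift (fun a b ab =>
    mktrilin (@gassoc_linear1 U V W _ _ _ _ _ gc ab)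
      (@gassoc_linear2 U V W _ _ _ _ _ gc ab)
      (@gassoc_linear3 U V W _ _ _ _ _ gc ab))).

Definition gassocV U V W : ghom (gtens U (gtens V W)) (gtens (gtens U V) W) :=
  fun d => glift (fun a g ag => linflip (glift (fun b c bc =>
    mktrilin (@gassocV_linear1 U V W _ _ _ _ _ ag bc)
      (@gassocV_linear2 U V W _ _ _ _ _ ag bc)
      (@gassocV_linear3 U V W _ _ _ _ _ ag bc)))).

Lemma gtmapE V V' W W' (f : ghom V V') (g : ghom W W') a b c (abc : a + b = c)
    x y :
  gtmap f g c (ggen V W abc x y) = ggen V' W' abc (f a x) (g b y).
Proof. exact: gliftE. Qed.

Lemma gsymE V W a b c (abc : a + b = c) x y :
  gsym V W c (ggen V W abc x y) = ggen W V (decompC abc) y x.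
Proof. exact: gliftE. Qed.

Lemma gassocE U V W a b c g d (gc : g + c = d) (ab : a + b = g) x y z :
  gassoc U V W d (ggen (gtens U V) W gc (ggen U V ab x y) z) =
  ggen U (gtens V W) (decompA gc ab) x (ggen V W erefl y z).
Proof. by rewrite [LHS]gliftE gliftE. Qed.

Lemma gassocVE U V W a b c g d (ag : a + g = d) (bc : b + c = g) x y z :
  gassocV U V W d (ggen U (gtens V W) ag x (ggen V W bc y z)) =
  ggen (gtens U V) W (decompAV ag bc) (ggen U V erefl x y) z.
Proof. by rewrite [LHS]gliftE linflipE gliftE. Qed.

Lemma gcompE U V W (g : ghom V W) (f : ghom U V) c x :
  gcomp g f c x = g c (f c x).
Proof. by []. Qed.

#[local] Opaque gtens ggen glift gtmap gsym gassoc gassocV gcomp.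

Lemma gtens_extl U V W d (Z : lmodType K)
    (f h : {linear gtens (gtens U V) W d -> Z}) :
  (forall a b g c (gc : g + c = d) (ab : a + b = g) x y z,
     f (ggen (gtens U V) W gc (ggen U V ab x y) z) =
     h (ggen (gtens U V) W gc (ggen U V ab x y) z)) ->
  f = h.
Proof.
move=> fh; apply: gtens_ext => g c gc t z.
pose i : {linear gtens U V g -> gtens (gtens U V) W d} :=
  linflip (ggen (gtens U V) W gc) z.
have: f \o i = h \o i :> {linear _ -> Z}.
  by apply: gtens_ext => a b ab x y; apply: fh.
by move=> /(congr1 (fun k : {linear _ -> Z} => k t)).
Qed.

Lemma gtens_extr U V W d (Z : lmodType K)
    (f h : {linear gtens U (gtens V W) d -> Z}) :
  (forall a b g c (ag : a + g = d) (bc : b + c = g) x y z,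
     f (ggen U (gtens V W) ag x (ggen V W bc y z)) =
     h (ggen U (gtens V W) ag x (ggen V W bc y z))) ->
  f = h.
Proof.
move=> fh; apply: gtens_ext => a g ag x t.
pose i : {linear gtens V W g -> gtens U (gtens V W) d} :=
  ggen U (gtens V W) ag x.
have: f \o i = h \o i :> {linear _ -> Z}.
  by apply: gtens_ext => b c bc y z; apply: fh.
by move=> /(congr1 (fun k : {linear _ -> Z} => k t)).
Qed.

Lemma ggen_irr V W a b c (e e' : a + b = c) x y :
  ggen V W e x y = ggen V W e' x y.
Proof. by rewrite (eq_irrelevance e e'). Qed.

Lemma gidmE V a x : gidm V a x = x. Proof. by []. Qed.

Lemma ggen_irr2 U V W a b c g g' d (e : a + g = d) (e' : a + g' = d)
    (f : b + c = g) (f' : b + c = g') x y z :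
  ggen U (gtens V W) e x (ggen V W f y z) =
  ggen U (gtens V W) e' x (ggen V W f' y z).
Proof.
by case: g / f in e *; case: g' / f' in e' *; rewrite (eq_irrelevance e e').
Qed.

Fact gcomp_linl U V W (f : ghom U V) :
  linear (fun g : ghom V W => gcomp g f).
Proof.
move=> k g h; apply: dprod_ext => c; apply: linear_ext => x.
by rewrite gcompE [RHS](_ : _ = k *: gcomp g f c x + gcomp h f c x) // !gcompE.
Qed.

Fact gcomp_linr U V W (g : ghom V W) :
  linear (fun f : ghom U V => gcomp g f).
Proof.
move=> k f h; apply: dprod_ext => c; apply: linear_ext => x.
rewrite gcompE [RHS](_ : _ = k *: gcomp g f c x + gcomp g h c x) // !gcompE.
exact: linearP.
Qed.

Fact gcomp1m V W (f : ghom V W) : gcomp (gidm W) f = f.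
Proof. by apply: dprod_ext => c; apply: linear_ext => x; rewrite gcompE. Qed.

Fact gcompm1 V W (f : ghom V W) : gcomp f (gidm V) = f.
Proof. by apply: dprod_ext => c; apply: linear_ext => x; rewrite gcompE. Qed.

Fact gcompA U V W X (h : ghom W X) (g : ghom V W) (f : ghom U V) :
  gcomp h (gcomp g f) = gcomp (gcomp h g) f.
Proof.
by apply: dprod_ext => c; apply: linear_ext => x; rewrite -> !gcompE.
Qed.

Fact gtmap1 V W : gtmap (gidm V) (gidm W) = gidm (gtens V W).
Proof.
by apply: dprod_ext => c; apply: gtens_ext => a b abc x y; rewrite gtmapE.
Qed.

Fact gtmap_comp V V' V'' W W' W'' (f' : ghom V' V'') (f : ghom V V')
    (g' : ghom W' W'') (g : ghom W W') :
  gtmap (gcomp f' f) (gcomp g' g) = gcomp (gtmap f' g') (gtmap f g).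
Proof.
apply: dprod_ext => c; apply: gtens_ext => a b abc x y.
by rewrite gcompE !gtmapE.
Qed.

Fact gtmap_linl V V' W W' (g : ghom W W') :
  linear (fun f : ghom V V' => gtmap f g).
Proof.
move=> k f f'; apply: dprod_ext => c; apply: gtens_ext => a b abc x y.
rewrite gtmapE [RHS](_ : _ = k *: gtmap f g c (ggen V W abc x y) +
  gtmap f' g c (ggen V W abc x y)) // !gtmapE.
by rewrite [ggen _ _ _ _]linearP.
Qed.

Fact gtmap_linr V V' W W' (f : ghom V V') :
  linear (fun g : ghom W W' => gtmap f g).
Proof.
move=> k g g'; apply: dprod_ext => c; apply: gtens_ext => a b abc x y.
rewrite gtmapE [RHS](_ : _ = k *: gtmap f g c (ggen V W abc x y) +
  gtmap f g' c (ggen V W abc x y)) // !gtmapE.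
by rewrite linearP.
Qed.

Fact gassocK U V W : gcomp (gassocV U V W) (gassoc U V W) = gidm _.
Proof.
apply: dprod_ext => d; apply: gtens_extl => a b g c gc ab x y z.
by rewrite gcompE gassocE gassocVE; case: g / ab in gc *; apply: ggen_irr.
Qed.

Fact gassocVK U V W : gcomp (gassoc U V W) (gassocV U V W) = gidm _.
Proof.
apply: dprod_ext => d; apply: gtens_extr => a b g c ag bc x y z.
by rewrite gcompE gassocVE gassocE; case: g / bc in ag *; apply: ggen_irr.
Qed.

Fact gassoc_nat U U' V V' W W' (f : ghom U U') (g : ghom V V')
    (h : ghom W W') :
  gcomp (gassoc U' V' W') (gtmap (gtmap f g) h) =
  gcomp (gtmap f (gtmap g h)) (gassoc U V W).
Proof.
apply: dprod_ext => d; apply: gtens_extl => a b e c ec ab x y z.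
rewrite gcompE [RHS]gcompE gassocE gtmapE gtmapE [RHS]gtmapE [LHS]gassocE.
by rewrite gtmapE.
Qed.

Lemma gtens_extll U V W X d (Z : lmodType K)
    (f h : {linear gtens (gtens (gtens U V) W) X d -> Z}) :
  (forall a a' g b e c (ec : e + c = d) (gb : g + b = e) (aa : a + a' = g)
      x y z t,
     f (ggen (gtens (gtens U V) W) X ec
         (ggen (gtens U V) W gb (ggen U V aa x y) z) t) =
     h (ggen (gtens (gtens U V) W) X ec
         (ggen (gtens U V) W gb (ggen U V aa x y) z) t)) ->
  f = h.
Proof.
move=> fh; apply: gtens_ext => e c ec s t.
pose i : {linear gtens (gtens U V) W e -> gtens (gtens (gtens U V) W) X d} :=
  linflip (ggen (gtens (gtens U V) W) X ec) t.
have: f \o i = h \o i :> {linear _ -> Z}.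
  by apply: gtens_extl => a b g b' gb ab x y z; apply: fh.
by move=> /(congr1 (fun k : {linear _ -> Z} => k s)).
Qed.

Fact gpentagon U V W X :
  gcomp (gassoc U V (gtens W X)) (gassoc (gtens U V) W X) =
  gcomp (gtmap (gidm U) (gassoc V W X))
    (gcomp (gassoc U (gtens V W) X) (gtmap (gassoc U V W) (gidm X))).
Proof.
apply: dprod_ext => d; apply: gtens_extll => a a' g b e c ec gb aa x y z t.
rewrite -> !gcompE.
rewrite -> (gtmapE _ _ ec).
rewrite -> !gassocE.
rewrite -> gtmapE.
rewrite -> gassocE.
case: g / aa in gb *; case: e / gb in ec *.
rewrite -> !gidmE.
exact: ggen_irr2.
Qed.

Fact gsymK V W : gcomp (gsym W V) (gsym V W) = gidm (gtens V W).
Proof.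
apply: dprod_ext => c; apply: gtens_ext => a b abc x y.
by rewrite gcompE gsymE gsymE; apply: ggen_irr.
Qed.

Fact gsym_nat V V' W W' (f : ghom V V') (g : ghom W W') :
  gcomp (gsym V' W') (gtmap f g) = gcomp (gtmap g f) (gsym V W).
Proof.
apply: dprod_ext => c; apply: gtens_ext => a b abc x y.
rewrite -> !gcompE.
rewrite -> gtmapE.
rewrite -> !gsymE.
rewrite -> gtmapE.
by [].
Qed.

Fact ghexagon U V W :
  gcomp (gassoc V W U) (gcomp (gsym U (gtens V W)) (gassoc U V W)) =
  gcomp (gtmap (gidm V) (gsym U W))
    (gcomp (gassoc V U W) (gtmap (gsym U V) (gidm W))).
Proof.
apply: dprod_ext => d; apply: gtens_extl => a b g c gc ab x y z.
rewrite -> !gcompE.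
rewrite -> (gtmapE _ _ gc).
rewrite -> !gsymE.
rewrite -> !gassocE.
rewrite -> !gsymE.
rewrite -> !gassocE.
rewrite -> gtmapE.
rewrite -> !gsymE.
exact: ggen_irr2.
Qed.

Definition VecS : linSymMonCat K := {|
  obj := gspace;
  mor := ghom;
  mid := gidm;
  mcomp := gcomp;
  tob := gtens;
  tmap := gtmap;
  massoc := gassoc;
  massocV := gassocV;
  msym := gsym;
  comp1m := gcomp1m;
  compm1 := gcompm1;
  compA := gcompA;
  comp_linl := gcomp_linl;
  comp_linr := gcomp_linr;
  tmap1 := gtmap1;
  tmap_comp := gtmap_comp;
  tmap_linl := gtmap_linl;
  tmap_linr := gtmap_linr;
  assocK := gassocK;
  assocVK := gassocVK;
  assoc_nat := gassoc_nat;
  pentagon := gpentagon;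
  msymK := gsymK;
  sym_nat := gsym_nat;
  hexagon := ghexagon
|}.

End GradedSpaces.

Section Uniform.
Variables (K : fieldType) (S : addSemigroupType) (A : lmodType K).

Definition uniform : obj (VecS K S) := fun=> A.

Section Components.
Variable mu : mor (tob uniform uniform) uniform.
Variables a b : S.

Definition component_fun (x y : A) : A :=
  (mu : ghom (gtens uniform uniform) uniform) (a + b)
    (ggen uniform uniform (erefl (a + b)) x y).

Fact component_bilinear : bilinear_for *:%R *:%R component_fun.
Proof.
split=> [y|x] k u v; rewrite /component_fun; last by rewrite !linearP.
by rewrite [ggen _ _ _ _]linearP [LHS]linearP.
Qed.

Definition component : {bilinear A -> A -> A} := HB.pack component_fun
  (bilinear_isBilinear.Build K A A A *:%R *:%R component_fun
    component_bilinear).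

End Components.

Definition rel_ops := S -> S -> {bilinear A -> A -> A}.

Definition components (mu : mor (tob uniform uniform) uniform) : rel_ops :=
  component mu.

Definition is_rel_comm (m : rel_ops) : Prop :=
  (forall a b c x y z,
     m (a + b) c (m a b x y) z = m a (b + c) x (m b c y z)) /\
  (forall a b x y, m a b x y = m b a y x).

Definition is_rel_lie (l : rel_ops) : Prop :=
  (forall a b x y, l a b x y + l b a y x = 0) /\
  (forall a b c x y z,
     l (a + b) c (l a b x y) z + l (c + a) b (l c a z x) y
       + l (b + c) a (l b c y z) x = 0).

Definition is_rel_poisson (m l : rel_ops) : Prop :=
  [/\ is_rel_comm m, is_rel_lie l &
      forall a b c x y z,
        l a (b + c) x (m b c y z) =
        m (a + b) c (l a b x y) z + m b (a + c) y (l a c x z)].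

End Uniform.

Arguments uniform {K} S A.

(* Main.v *)
(* Pure tensors generate the graded tensor powers, so a morphism out of U(A)U(A)
   or (U(A)U(A))U(A) is determined by its values on them, and each monoid axiom
   evaluated on pure tensors of degrees (a, b) or (a, b, c) is the corresponding
   identity between components. *)
Require Import Defs.
From HB Require Import structures.
From mathcomp Require Import all_boot all_algebra.
From mathcomp Require Import boolp.

Set Implicit Arguments.
Unset Strict Implicit.
Unset Printing Implicit Defensive.

Import GRing.Theory.
Local Open Scope ring_scope.

Local Notation "g \oc f" := (mcomp g f) (at level 40, left associativity).
Local Notation "X \bx Y" := (tob X Y) (at level 38, left associativity).
Local Notation "f \bxm g" := (tmap f g) (at level 38, left associativity).

#[local] Opaque gtens ggen glift gtmap gsym gassoc gassocV gcomp.

(** Beyond its function, a bundled bilinear map carries only propositions, which proof irrelevance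
    identifies. *)
Lemma bilinear_ext (K : fieldType) (U V W : lmodType K)
    (f g : {bilinear U -> V -> W}) :
  (forall x y, f x y = g x y) -> f = g.
Proof.
move: f g => [f [[f1 f2 f3 f4]]] [g [[g1 g2 g3 g4]]] /= fg.
have {}fg : f = g by apply/funext => x; apply/funext => y; apply: fg.
subst g; rewrite (Prop_irrelevance f1 g1) (Prop_irrelevance f2 g2).
by rewrite (Prop_irrelevance f3 g3) (Prop_irrelevance f4 g4).
Qed.

Section GradedMorphisms.
Variables (K : fieldType) (S : addSemigroupType) (V W : gspace K S).

Lemma ghomDE (f g : ghom V W) a x : (f + g) a x = f a x + g a x.
Proof. by []. Qed.

(** This is the shape of the Jacobi axiom, with [t] the cyclic permutation. *)
Lemma gcomp_powers (f : ghom V W) (t : ghom V V) a x :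
  gcomp f (gidm V + t + gcomp t t) a x =
  f a x + f a (t a x) + f a (t a (t a x)).
Proof. by rewrite -[t a (t a x)]gcompE -!linearD gcompE. Qed.

End GradedMorphisms.

Section Uniform.
Variables (K : fieldType) (S : addSemigroupType) (A : lmodType K).

Local Notation U := (uniform S A).
Local Notation UU := (gtens U U).
Local Notation gen3 gc ab x y z := (ggen UU U gc (ggen U U ab x y) z).

Implicit Types (mu l : mor (U \bx U) U) (a b c d : S) (x y z : A).

(** [component] evaluates [mu] in degree [a + b] with a reflexivity proof; eliminating [abc] reaches
    every other presentation of that degree. *)
Lemma componentsE (mu : ghom UU U) a b c (abc : a + b = c) x y :
  mu c (ggen U U abc x y) = components mu a b x y.
Proof. by case: c / abc. Qed.

Section OfComponents.
Variables (m : rel_ops S A) (a b : S).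

Fact of_components_linearl y : linear (fun x => m a b x y).
Proof. by move=> k u v; rewrite linearPl. Qed.
Fact of_components_linearr x : linear (fun y => m a b x y).
Proof. by move=> k u v; rewrite linearPr. Qed.

End OfComponents.

(** The inverse of [components]. It is well typed by uniformity: [U] is [A] in every degree, so
    [m a b x y] lies in degree [c] without transport. *)
Definition of_components (m : rel_ops S A) : ghom UU U :=
  fun c => glift (fun a b (_ : a + b = c) =>
    mkbilin (@of_components_linearl m a b) (@of_components_linearr m a b)).

Lemma of_componentsE m a b c (abc : a + b = c) x y :
  of_components m c (ggen U U abc x y) = m a b x y.
Proof. exact: gliftE. Qed.

Lemma components_bij : bijective (@components K S A).
Proof.
exists of_components => [mu|m].
  apply: dprod_ext => c; apply: gtens_ext => a b abc x y.
  by rewrite of_componentsE -(componentsE mu abc).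
apply/funext => a; apply/funext => b; apply: bilinear_ext => x y.
by rewrite -(componentsE _ (erefl (a + b))) of_componentsE.
Qed.

Lemma ghom2P mu l :
  mu = l <-> forall a b x y, components mu a b x y = components l a b x y.
Proof.
split=> [-> //|e]; apply: dprod_ext => c; apply: gtens_ext => a b abc x y.
by rewrite !componentsE.
Qed.

Lemma ghom3P (f g : ghom (gtens UU U) U) :
  f = g <-> forall a b c x y z,
    f (a + b + c) (gen3 erefl erefl x y z) =
    g (a + b + c) (gen3 erefl erefl x y z).
Proof.
split=> [-> //|e]; apply: dprod_ext => d.
apply: gtens_extl => a b g' c gc ab x y z.
(* The inner and total degrees are forced to be [a + b] and [a + b + c], so only reflexivity proofs
   remain. *)
by case: g' / ab gc; case: d /.
Qed.

Lemma components_sym mu a b x y :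
  components (gcomp mu (gsym U U)) a b x y = components mu b a y x.
Proof. by rewrite -(componentsE _ (erefl (a + b))) gcompE gsymE componentsE. Qed.

(** The degree proofs are arbitrary here and in [comp_idr], because permuting factors yields proofs
    other than reflexivity. *)
Lemma comp_idl mu l a b c d g (gc : g + c = d) (ab : a + b = g) x y z :
  gcomp mu (gtmap l (gidm U)) d (gen3 gc ab x y z) =
  components mu (a + b) c (components l a b x y) z.
Proof.
rewrite gcompE gtmapE gidmE !componentsE.
by case: g / ab gc.
Qed.

Lemma comp_idr mu l a b c d g (gc : g + c = d) (ab : a + b = g) x y z :
  gcomp (gcomp mu (gtmap (gidm U) l)) (gassoc U U U) d (gen3 gc ab x y z) =
  components mu a (b + c) x (components l b c y z).
Proof.
by rewrite gcompE gassocE gcompE gtmapE gidmE !componentsE.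
Qed.

(** The symmetry moves [z] in front of the pair [x], [y], and the inverse associator regroups. The
    output has the shape of the input, so the lemma can be iterated. *)
Lemma cyc3_gen a b c d g (gc : g + c = d) (ab : a + b = g)
    (e : c + a + b = d) x y z :
  (cyc3 U : ghom _ _) d (gen3 gc ab x y z) =
  gen3 e erefl z x y.
Proof.
by rewrite /cyc3 /= gcompE gsymE gassocVE; apply: ggen_irr.
Qed.

Lemma jacobiator_gen l a b c x y z :
  (l \oc (l \bxm mid U) \oc (mid (U \bx U \bx U) + cyc3 U + cyc3 U \oc cyc3 U)
    : ghom (gtens UU U) U) (a + b + c) (gen3 erefl erefl x y z) =
  components l (a + b) c (components l a b x y) z
    + components l (c + a) b (components l c a z x) y
    + components l (b + c) a (components l b c y z) x.
Proof.
(* Commutativity of [S] puts all three rotations in the same degree. *)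
have cab : c + a + b = a + b + c by rewrite -Algebra.addrA Algebra.addrC.
have bca : b + c + a = a + b + c by rewrite Algebra.addrC Algebra.addrA.
rewrite [LHS](gcomp_powers (gcomp l (gtmap l (gidm U))) (cyc3 U)).
by rewrite (cyc3_gen _ _ cab) (cyc3_gen _ _ bca) !comp_idl.
Qed.

Lemma comm_monoidP mu : is_comm_monoid mu <-> is_rel_comm (components mu).
Proof.
have assocP : mu \oc (mid U \bxm mu) \oc massoc U U U =
    mu \oc (mu \bxm mid U) <->
  forall a b c x y z, components mu (a + b) c (components mu a b x y) z =
    components mu a (b + c) x (components mu b c y z).
  rewrite ghom3P; split=> e a b c x y z; move: (e a b c x y z);
  by rewrite comp_idl comp_idr => ->.
have symP : mu \oc msym U U = mu <->
  forall a b x y, components mu a b x y = components mu b a y x.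
  rewrite ghom2P; split=> e a b x y; move: (e a b x y);
  by rewrite components_sym => ->.
by split=> -[/assocP mA /symP mC].
Qed.

Lemma lie_monoidP l : is_lie_monoid l <-> is_rel_lie (components l).
Proof.
have antiP : l + l \oc msym U U = 0 <->
  forall a b x y, components l a b x y + components l b a y x = 0.
  rewrite ghom2P; split=> e a b x y; move: (e a b x y);
  (* Sum and zero of morphisms are pointwise, so the rest holds by computation. *)
  by rewrite -(components_sym l a).
split=> -[/antiP lA lJ]; split=> //.
  by move=> a b c x y z; rewrite -jacobiator_gen lJ.
by apply/ghom3P => a b c x y z; rewrite jacobiator_gen lJ.
Qed.

(** Swapping [x] and [y] turns the last summand into [comp_idr] in degrees [b], [a], [c]. *)
Lemma leibniz_gen mu l a b c x y z :
  (mu \oc (l \bxm mid U) +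
    mu \oc (mid U \bxm l) \oc massoc U U U \oc (msym U U \bxm mid U)
    : ghom (gtens UU U) U) (a + b + c) (gen3 erefl erefl x y z) =
  components mu (a + b) c (components l a b x y) z +
    components mu b (a + c) y (components l a c x z).
Proof.
rewrite ghomDE comp_idl; congr (_ + _).
by rewrite gcompE gtmapE gsymE gidmE comp_idr.
Qed.

(** For the Leibniz law, the left side is [comp_idr] with [mu] and [l] exchanged, and the right side
    is [leibniz_gen]. *)
Lemma poisson_monoidP mu l :
  is_poisson_monoid mu l <-> is_rel_poisson (components mu) (components l).
Proof.
split=> -[/comm_monoidP mP /lie_monoidP lP D]; split=> //.
  by move=> a b c x y z; rewrite -leibniz_gen -D comp_idr.
by apply/ghom3P => a b c x y z; rewrite leibniz_gen comp_idr.
Qed.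

End Uniform.

Theorem proposition3p5 (K : fieldType) (S : addSemigroupType)
    (A : lmodType K) :
  [/\ bijective (@components K S A),
      forall mu : mor (tob (uniform S A) (uniform S A)) (uniform S A),
        is_comm_monoid mu <-> is_rel_comm (components mu),
      forall l : mor (tob (uniform S A) (uniform S A)) (uniform S A),
        is_lie_monoid l <-> is_rel_lie (components l) &
      forall mu l : mor (tob (uniform S A) (uniform S A)) (uniform S A),
        is_poisson_monoid mu l <->
        is_rel_poisson (components mu) (components l)].
Proof.
split; [exact: components_bij | exact: comm_monoidP | exact: lie_monoidP |].
exact: poisson_monoidP.
Qed.
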